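(* Let $f\in C^2(0,\infty)$ with $f'>0$ and $f''>0$, let $\rho_l,\rho_r>0$ and $u_l>u_r$. For $\epsilon>0$ sufficiently small, let $(u^\epsilon,\rho^\epsilon)$ be the Lax-admissible two-shock solution of $$u_t+\Big(\frac{u^2}{2}+\epsilon f(\rho)\Big)_x=0,\qquad \rho_t+(u\rho-\epsilon\rho)_x=0,\qquad x\in\mathbb{R},\ t>0,$$ with initial data $(u_l,\rho_l)$ for $x<0$ and $(u_r,\rho_r)$ for $x>0$. Then, as $\epsilon\to0$, the pointwise limit of $u^\epsilon$ is $$u(x,t)=\begin{cases}u_l, & x<\frac{u_l+u_r}{2}t,\\[2pt] \frac{u_l+u_r}{2}, & x=\frac{u_l+u_r}{2}t,\\[2pt] u_r, & x>\frac{u_l+u_r}{2}t,\end{cases}$$ and the distributional limit of $\rho^\epsilon$ is the measure $\rho$ which equals $\rho_l$ in the region $x<\frac{u_l+u_r}{2}t$, equals $\rho_r$ in the region $x>\frac{u_l+u_r}{2}t$, and equals the weighted delta distribution $$(u_l-u_r)\,\frac{\rho_l+\rho_r}{2}\,t\,\delta_{x=\frac{u_l+u_r}{2}t}$$ on the line $x=\frac{u_l+u_r}{2}t$.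
   Context: The weighted $\delta$-distribution $d(t)\delta_{x=c(t)}$ concentrated on a smooth curve $x=c(t)$ is defined by $\langle d(t)\delta_{x=c(t)},\varphi\rangle=\int_0^\infty d(t)\varphi(c(t),t)\,dt$ for all $\varphi\in C_c^\infty(\mathbb{R}\times(0,\infty))$. The Lax-admissible two-shock solution: for $u_l>u_r$ and $\epsilon>0$ small there is a unique intermediate state $(u^*_\epsilon,\rho^*_\epsilon)$ such that $(u_l,\rho_l)$ is connected to $(u^*_\epsilon,\rho^*_\epsilon)$ by a Lax-admissible 1-shock of speed $s_{1,\epsilon}$, and $(u^*_\epsilon,\rho^*_\epsilon)$ is connected to $(u_r,\rho_r)$ by a Lax-admissible 2-shock of speed $s_{2,\epsilon}$. Then $(u^\epsilon,\rho^\epsilon)$ equals $(u_l,\rho_l)$ for $x<s_{1,\epsilon}t$, $(u^*_\epsilon,\rho^*_\epsilon)$ for $s_{1,\epsilon}t<x<s_{2,\epsilon}t$, and $(u_r,\rho_r)$ for $x>s_{2,\epsilon}t$. Here a shock of speed $s$ from left state $(\bar u,\bar\rho)$ to right state $(u,\rho)$ satisfies the Rankine-Hugoniot conditions $$(u-\bar u)s=\tfrac12(u^2-\bar u^2)+\epsilon(f(\rho)-f(\bar\rho)),\qquad (\rho-\bar\rho)s=(\rho u-\bar\rho\bar u)-\epsilon(\rho-\bar\rho).$$ With $\lambda_{1}(u,\rho)=u-\frac{\epsilon}{2}-\frac12\sqrt{4\epsilon\rho f'(\rho)+\epsilon^2}$ and $\lambda_{2}(u,\rho)=u-\frac{\epsilon}{2}+\frac12\sqrt{4\epsilon\rho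 f'(\rho)+\epsilon^2}$, it is a Lax-admissible 1-shock if $s<\lambda_1(\bar u,\bar\rho)$ and $\lambda_1(u,\rho)<s<\lambda_2(u,\rho)$, and a Lax-admissible 2-shock if $s>\lambda_2(u,\rho)$ and $\lambda_1(\bar u,\bar\rho)<s<\lambda_2(\bar u,\bar\rho)$. *)

(* Defs.v *)
From HB Require Import structures.
From mathcomp Require Import all_boot all_order all_algebra.
From mathcomp Require Import all_classical all_reals all_analysis.

Set Implicit Arguments.
Unset Strict Implicit.
Unset Printing Implicit Defensive.

Import Order.TTheory GRing.Theory Num.Theory.
Import numFieldNormedType.Exports.

Local Open Scope ring_scope.
Local Open Scope classical_set_scope.

(* Points of the (x, t) plane are pairs p with p.1 = x and p.2 = t. *)

Section ScalarFunctions.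
Context {R : realType}.

(* C^2 on the open half-line; values of f outside it are irrelevant. *)
Definition C2_on_pos (f : R -> R) : Prop :=
  forall r : R, 0 < r ->
    [/\ derivable f r 1, derivable f^`() r 1 & {for r, continuous f^`(2)}].

End ScalarFunctions.

Section Distributions.
Context {R : realType}.

Definition upper_half_plane : set (R * R) := [set p | 0 < p.2].

Fixpoint C_n (n : nat) (g : R * R -> R) : Prop :=
  if n is m.+1 then
    [/\ continuous g,
        (forall p, derivable g p (1, 0) /\ derivable g p (0, 1)),
        C_n m (fun p => 'D_(1, 0) g p) &
        C_n m (fun p => 'D_(0, 1) g p)]
  else continuous g.

(* An element of C_c^oo(R x (0, +oo)) is represented by its extension by zero
   to the whole plane, which is again smooth. *)
Definition test_function (phi : R * R -> R) : Prop :=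
  let supp := closure [set p | phi p != 0] in
  [/\ forall n, C_n n phi, compact supp & supp `<=` upper_half_plane].

(* The distribution on R x (0, +oo) given by the function g on the region A
   and by 0 off A. *)
Definition regular_distribution (A : set (R * R)) (g : R * R -> R)
    (phi : R * R -> R) : R :=
  \int[(@lebesgue_measure R \x @lebesgue_measure R)%E]_(p in
      A `&` upper_half_plane) (g p * phi p).

(* d(t) delta_{x = c(t)} *)
Definition weighted_delta (d c : R -> R) (phi : R * R -> R) : R :=
  \int[@lebesgue_measure R]_(t in `]0, +oo[) (d t * phi (c t, t)).

End Distributions.

Section TwoShocks.
Context {R : realType}.
Variables (f : R -> R) (eps : R).

Definition lambda1 (u rho : R) : R :=
  u - eps / 2 - Num.sqrt (4 * eps * rho * f^`()%classic rho + eps ^+ 2) / 2.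

Definition lambda2 (u rho : R) : R :=
  u - eps / 2 + Num.sqrt (4 * eps * rho * f^`()%classic rho + eps ^+ 2) / 2.

Definition rankine_hugoniot (s ub rhob u rho : R) : Prop :=
  (u - ub) * s = (u ^+ 2 - ub ^+ 2) / 2 + eps * (f rho - f rhob) /\
  (rho - rhob) * s = (rho * u - rhob * ub) - eps * (rho - rhob).

Definition lax_1shock (s ub rhob u rho : R) : Prop :=
  rankine_hugoniot s ub rhob u rho /\
  s < lambda1 ub rhob /\ lambda1 u rho < s < lambda2 u rho.

Definition lax_2shock (s ub rhob u rho : R) : Prop :=
  rankine_hugoniot s ub rhob u rho /\
  lambda2 u rho < s /\ lambda1 ub rhob < s < lambda2 ub rhob.

(* The values on the two shock rays themselves are left unspecified;
   measurability guarantees that they do not affect the integrals. *)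
Definition lax_two_shock_solution (ul rhol ur rhor : R)
    (u rho : R * R -> R) : Prop :=
  measurable_fun (@upper_half_plane R) u /\
  measurable_fun (@upper_half_plane R) rho /\
  exists us rhos s1 s2 : R,
    [/\ 0 < rhos,
        lax_1shock s1 ul rhol us rhos,
        lax_2shock s2 us rhos ur rhor &
        forall x t : R, 0 < t ->
          [/\ x < s1 * t -> u (x, t) = ul /\ rho (x, t) = rhol,
              s1 * t < x < s2 * t -> u (x, t) = us /\ rho (x, t) = rhos &
              s2 * t < x -> u (x, t) = ur /\ rho (x, t) = rhor]].

End TwoShocks.

Section Limits.
Context {R : realType}.
Variables (ul rhol ur rhor : R).

Definition limit_speed : R := (ul + ur) / 2.

Definition limit_u (x t : R) : R :=
  if x < limit_speed * t then ul
  else if x == limit_speed * t then (ul + ur) / 2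
  else ur.

Definition limit_rho (phi : R * R -> R) : R :=
  regular_distribution [set p | p.1 < limit_speed * p.2] (cst rhol) phi +
  regular_distribution [set p | limit_speed * p.2 < p.1] (cst rhor) phi +
  weighted_delta (fun t => (ul - ur) * ((rhol + rhor) / 2) * t)
                 (fun t => limit_speed * t) phi.

End Limits.

(* Main.v *)
(* Write a = ul - s1 - eps, b = us - s1 - eps, c = s2 + eps - us and
   d = s2 + eps - ur. Conservation of mass reads rhos b = rhol a and
   rhos c = rhor d, and the Lax conditions together with the monotonicity of
   rho f'(rho) force rhol, rhor < rhos. Since eps f(rhos) stays bounded away
   from 0, rhos tends to +oo; hence s2 - s1 = b + c tends to 0 while
   rhos (s2 - s1) = rhol a + rhor d tends to (ul - ur) (rhol + rhor) / 2, the
   rate of growth of the mass of the delta shock. By Fubini, the integral of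
   rhos phi over the strip s1 t <= x <= s2 t is rhos (s2 - s1) times the
   integral of t phi(m t, t), up to the oscillation of phi, with
   m = (ul + ur) / 2. *)
Require Import Defs.
From HB Require Import structures.
From mathcomp Require Import all_boot all_order all_algebra.
From mathcomp Require Import all_classical all_reals all_analysis measurable_realfun.
From mathcomp Require Import ring lra.

Set Implicit Arguments.
Unset Strict Implicit.
Unset Printing Implicit Defensive.

Import Order.TTheory GRing.Theory Num.Theory.
Import numFieldNormedType.Exports.

Local Open Scope ring_scope.
Local Open Scope classical_set_scope.

(** * Monotonicity and convexity of the flux [f] on the positive half-line *)

Section Flux.
Context {R : realType}.
Variable f : R -> R.
Hypothesis f_C2 : C2_on_pos f.
Hypothesis f_incr : forall r : R, 0 < r -> 0 < f^`()%classic r.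
Hypothesis f_convex : forall r : R, 0 < r -> 0 < f^`(2)%classic r.

Lemma MVT_pos (g : R -> R) (x y : R) :
    (forall r, 0 < r -> derivable g r 1) -> 0 < x -> x < y ->
  exists2 c, x < c < y & g y - g x = g^`()%classic c * (y - x).
Proof.
move=> dg x0 xy.
have dg' r : x <= r -> derivable g r 1 by move=> xr; apply: dg; apply: lt_le_trans xr.
have [|z||c cxy E] := @MVT R g g^`()%classic x y; first exact: xy.
- rewrite in_itv/= => /andP[xz _].
  rewrite derive1E; apply: derivableP; apply: dg'; exact: ltW.
- apply: derivable_within_continuous => z; rewrite in_itv/= => /andP[xz _].
  exact: dg'.
- by exists c => //; move: cxy; rewrite in_itv.
Qed.

Let flux_derivable (r : R) : 0 < r -> derivable f r 1.
Proof. by case/f_C2. Qed.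

Let flux_derive1_derivable (r : R) : 0 < r -> derivable f^`()%classic r 1.
Proof. by case/f_C2. Qed.

Lemma flux_lt (x y : R) : 0 < x -> x < y -> f x < f y.
Proof.
move=> x0 xy.
have [c /andP[xc _] E] := MVT_pos flux_derivable x0 xy.
rewrite -subr_gt0 E mulr_gt0 ?subr_gt0//.
exact/f_incr/(lt_trans x0).
Qed.

Lemma flux_le (x y : R) : 0 < x -> x <= y -> f x <= f y.
Proof.
move=> x0; rewrite le_eqVlt => /predU1P[->//|xy]; exact/ltW/flux_lt.
Qed.

Lemma flux_derive_le (x y : R) : 0 < x -> x <= y -> f^`()%classic x <= f^`()%classic y.
Proof.
move=> x0; rewrite le_eqVlt => /predU1P[->//|xy].
have [c /andP[xc _] E] := MVT_pos flux_derive1_derivable x0 xy.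
rewrite -subr_ge0 E mulr_ge0 ?subr_ge0 ?(ltW xy)//.
by have := f_convex (lt_trans x0 xc); rewrite derive1nS derive1n1 => /ltW.
Qed.

(** The product rho f'(rho) is what varies under the root in [lambda1] and [lambda2]; its
    monotonicity lets the Lax conditions compare densities. *)
Lemma flux_mulr_derive_le (x y : R) : 0 < x -> x <= y ->
  x * f^`()%classic x <= y * f^`()%classic y.
Proof.
move=> x0 xy; apply: ler_pM => //; first exact: ltW.
- exact/ltW/f_incr.
- exact: flux_derive_le.
Qed.

(** For x < y, convexity makes the chord over [x, z] at most as steep as the one over [y, z], and z
    - x < z; for y <= x monotonicity suffices. Both orders are covered because either of [rhol],
    [rhor] may be the larger. *)
Lemma flux_chord (x y z : R) : 0 < x -> 0 < y -> y < z ->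
  (f z - f x) * (z - y) <= z * (f z - f y).
Proof.
move=> x0 y0 yz; have fyz := flux_lt y0 yz.
have [yx|xy] := leP y x.
  have := flux_le y0 yx => fyx.
  apply: (@le_trans _ _ ((f z - f y) * (z - y))); nra.
have [c /andP[xc cy] E] := MVT_pos flux_derivable x0 xy.
have [c' /andP[yc cz] E'] := MVT_pos flux_derivable y0 yz.
have := flux_derive_le (lt_trans x0 xc) (ltW (lt_trans cy yc)) => cc'.
have P : 0 <= (y - x) * (z - y) * (f^`()%classic c' - f^`()%classic c).
  by rewrite mulr_ge0 ?mulr_ge0 ?subr_ge0// ltW.
have -> : f z - f x = (f z - f y) + (f y - f x) by ring.
rewrite E' E.
have := f_incr (lt_trans y0 yc) => f'c.
have : 0 <= x * (f^`()%classic c' * (z - y)) by rewrite !mulr_ge0 ?subr_ge0// ltW.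
nra.
Qed.

End Flux.

(** * Algebraic consequences of the Rankine-Hugoniot and Lax conditions at fixed [eps] *)

Section ShockAlgebra.
Context {R : realType}.
Variables (f : R -> R).
Hypothesis f_C2 : C2_on_pos f.
Hypothesis f_incr : forall r : R, 0 < r -> 0 < f^`()%classic r.
Hypothesis f_convex : forall r : R, 0 < r -> 0 < f^`(2)%classic r.
Variables (eps ul rhol us rhos ur rhor s1 s2 : R).

Let disc_gt0 (rho : R) : 0 < eps -> 0 < rho ->
  0 < 4 * eps * rho * f^`()%classic rho.
Proof. by move=> e0 r0; rewrite !mulr_gt0 ?f_incr. Qed.

(** Trades a square root for a variable with a known square, which polynomial arithmetic can
    handle. *)
Let sqrt_witness (x : R) : 0 <= x ->
  exists z : R, [/\ 0 <= z, z ^+ 2 = x & z = Num.sqrt x].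
Proof. by move=> x0; exists (Num.sqrt x); rewrite sqrtr_ge0 sqr_sqrtr. Qed.

Let sqr_lt (x y : R) : 0 <= x -> x < y -> x ^+ 2 < y ^+ 2.
Proof. by move=> x0 xy; nra. Qed.

(** The Lax conditions on [lambda1] read zl < 2a + eps and 2b + eps < zs, with zl, zs the two roots.
    If rhos <= rhol, mass conservation gives a <= b, and squaring contradicts the monotonicity of
    rho f'(rho). *)
Lemma lax_1shock_compressive : 0 < eps -> 0 < rhol -> 0 < rhos ->
    lax_1shock f eps s1 ul rhol us rhos ->
  [/\ rhos * (us - s1 - eps) = rhol * (ul - s1 - eps),
      (ul - us) * ((ul - s1 - eps + (us - s1 - eps)) / 2 + eps) =
        eps * (f rhos - f rhol),
      0 < us - s1 - eps, us < ul & rhol < rhos].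
Proof.
move=> eps_gt0 rhol_gt0 rhos_gt0 [[RH1 RH2] [L1 /andP[L2 L3]]].
move: L1 L2 L3; rewrite /lambda1 /lambda2.
set El := 4 * eps * rhol * _ + _; set Es := 4 * eps * rhos * _ + _.
have dl := disc_gt0 eps_gt0 rhol_gt0; have ds := disc_gt0 eps_gt0 rhos_gt0.
have El0 : 0 <= El by rewrite addr_ge0 ?sqr_ge0// ltW.
have Es0 : 0 <= Es by rewrite addr_ge0 ?sqr_ge0// ltW.
have [zl [zl0 Zl <-]] := sqrt_witness El0.
have [zs [zs0 Zs <-]] := sqrt_witness Es0 => L1 L2 L3.
set a := ul - s1 - eps; set b := us - s1 - eps.
have E1 : rhos * b = rhol * a by rewrite /a /b; nra.
(* The positive first term of the discriminant puts the root above [eps]; this is what makes a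
   positive. *)
have zl_eps : eps < zl.
  rewrite -(@ltr_pXn2r _ 2) ?nnegrE// ?(ltW eps_gt0)// Zl /El; lra.
have a0 : 0 < a by rewrite /a; lra.
have b0 : 0 < b by rewrite -(pmulr_rgt0 _ rhos_gt0) E1 mulr_gt0.
have E2 : (ul - us) * ((a + b) / 2 + eps) = eps * (f rhos - f rhol).
  by rewrite /a /b; lra.
have F1 : 4 * eps * (rhol * f^`()%classic rhol) < (2 * a + eps) ^+ 2 - eps ^+ 2.
  have : zl ^+ 2 < (2 * a + eps) ^+ 2.
    by apply: sqr_lt => //; rewrite /a; lra.
  by rewrite Zl /El; lra.
have F2 : (2 * b + eps) ^+ 2 - eps ^+ 2 < 4 * eps * (rhos * f^`()%classic rhos).
  have : (2 * b + eps) ^+ 2 < zs ^+ 2.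
    by move: b0; rewrite /b => b0; apply: sqr_lt; lra.
  by rewrite Zs /Es; lra.
have lr : rhol < rhos.
  rewrite ltNge; apply/negP => sl.
  have ab : a <= b by rewrite -(ler_pM2l rhol_gt0) -E1 ler_pM2r.
  have := flux_mulr_derive_le f_C2 f_incr f_convex rhos_gt0 sl => M.
  have : (2 * a + eps) ^+ 2 <= (2 * b + eps) ^+ 2.
    by rewrite ler_sqr ?nnegrE; lra.
  nra.
split => //.
suff : b < a by rewrite /a /b; lra.
by rewrite -(ltr_pM2l rhol_gt0) -E1 ltr_pM2r.
Qed.

(** Mirror image of the 1-shock: the Lax conditions on [lambda2] read zr < 2d - eps and 2c - eps <
    zs. *)
Lemma lax_2shock_compressive : 0 < eps -> 0 < rhor -> 0 < rhos ->
    lax_2shock f eps s2 us rhos ur rhor ->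
  [/\ rhos * (s2 + eps - us) = rhor * (s2 + eps - ur),
      (us - ur) * ((s2 + eps - us + (s2 + eps - ur)) / 2 - eps) =
        eps * (f rhos - f rhor),
      0 < s2 + eps - us, ur < us & rhor < rhos].
Proof.
move=> eps_gt0 rhor_gt0 rhos_gt0 [[RH1 RH2] [L1 /andP[L2 L3]]].
move: L1 L2 L3; rewrite /lambda1 /lambda2.
set Er := 4 * eps * rhor * _ + _; set Es := 4 * eps * rhos * _ + _.
have dr := disc_gt0 eps_gt0 rhor_gt0; have ds := disc_gt0 eps_gt0 rhos_gt0.
have Er0 : 0 <= Er by rewrite addr_ge0 ?sqr_ge0// ltW.
have Es0 : 0 <= Es by rewrite addr_ge0 ?sqr_ge0// ltW.
have [zr [zr0 Zr <-]] := sqrt_witness Er0.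
have [zs [zs0 Zs <-]] := sqrt_witness Es0 => L1 L2 L3.
set c := s2 + eps - us; set d := s2 + eps - ur.
have E1 : rhos * c = rhor * d by rewrite /c /d; nra.
have zr_eps : eps < zr.
  rewrite -(@ltr_pXn2r _ 2) ?nnegrE// ?(ltW eps_gt0)// Zr /Er; lra.
have d0 : eps < d by rewrite /d; lra.
have c0 : 0 < c.
  by rewrite -(pmulr_rgt0 _ rhos_gt0) E1 mulr_gt0// (lt_trans eps_gt0).
have E2 : (us - ur) * ((c + d) / 2 - eps) = eps * (f rhos - f rhor).
  by rewrite /c /d; lra.
have F1 : 4 * eps * (rhor * f^`()%classic rhor) < (2 * d - eps) ^+ 2 - eps ^+ 2.
  have : zr ^+ 2 < (2 * d - eps) ^+ 2.
    by apply: sqr_lt => //; rewrite /d; lra.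
  by rewrite Zr /Er; lra.
have lr : rhor < rhos.
  rewrite ltNge; apply/negP => sr.
  have dc : d <= c by rewrite -(ler_pM2l rhor_gt0) -E1 ler_pM2r.
  have := flux_mulr_derive_le f_C2 f_incr f_convex rhos_gt0 sr => M.
  (* Squaring needs 0 <= 2c - eps, which follows here from eps < d <= c, the second inequality being
     due to the contrary assumption. For the 1-shock, 2b + eps is positive outright. *)
  have F2 : (2 * c - eps) ^+ 2 < zs ^+ 2.
    by apply: sqr_lt => //; move: dc d0; rewrite /c /d; lra.
  have : (2 * d - eps) ^+ 2 <= (2 * c - eps) ^+ 2.
    by rewrite ler_sqr ?nnegrE; lra.
  move: F2; rewrite Zs /Es; nra.
split => //.
suff : c < d by rewrite /c /d; lra.
by rewrite -(ltr_pM2l rhor_gt0) -E1 ltr_pM2r.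
Qed.

(* The two shock speeds enclose the limit speed for every [eps], not only in the
   limit: otherwise the momentum jumps would violate convexity of [f]. *)
Lemma lax_two_shock_enclose :
    0 < eps -> 0 < rhol -> 0 < rhor -> 0 < rhos ->
    lax_1shock f eps s1 ul rhol us rhos ->
    lax_2shock f eps s2 us rhos ur rhor ->
  s1 < limit_speed ul ur < s2.
Proof.
move=> eps_gt0 rhol_gt0 rhor_gt0 rhos_gt0.
move=> /lax_1shock_compressive[]// M1 P1 b0 p0 lr1.
move=> /lax_2shock_compressive[]// M2 P2 c0 q0 lr2.
have XY := flux_chord f_C2 f_incr f_convex rhor_gt0 rhol_gt0 lr1.
have YX := flux_chord f_C2 f_incr f_convex rhol_gt0 rhor_gt0 lr2.
have X0 := flux_lt f_C2 f_incr rhol_gt0 lr1.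
have Y0 := flux_lt f_C2 f_incr rhor_gt0 lr2.
rewrite /limit_speed.
(* The flux jumps become variables [X] and [Y]; only their signs, the momentum relations and the two
   chord inequalities are kept. *)
move: (f rhos - f rhol) (f rhos - f rhor) (subr_gt0 (f rhol) (f rhos))
  (subr_gt0 (f rhor) (f rhos)) P1 P2 XY YX; rewrite X0 Y0 => X Y.
move=> /idP X0' /idP Y0'.
set a := ul - s1 - eps in M1 *; set b := us - s1 - eps in M1 b0 *.
set c := s2 + eps - us in M2 c0 *; set d := s2 + eps - ur in M2 *.
set P := (a + b) / 2 + eps; set Q := (c + d) / 2 - eps.
set p := ul - us; set q := us - ur => P1 P2 XY YX.
have pE : p = a - b by rewrite /p /a /b; ring.
have qE : q = d - c by rewrite /q /c /d; ring.
have p_gt0 : 0 < p by rewrite /p subr_gt0.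
have q_gt0 : 0 < q by rewrite /q subr_gt0.
have P0 : 0 < P by rewrite -(pmulr_rgt0 _ p_gt0) P1 mulr_gt0.
have Q0 : 0 < Q by rewrite -(pmulr_rgt0 _ q_gt0) P2 mulr_gt0.
have kl : (a + b) * (rhos - rhol) = p * (rhos + rhol) by rewrite pE; lra.
have kr : (c + d) * (rhos - rhor) = q * (rhos + rhor) by rewrite qE; lra.
have XY' : q * Q * (rhos - rhol) <= rhos * (p * P).
  by rewrite P1 P2 -mulrA [leRHS]mulrCA ler_pM2l.
have YX' : p * P * (rhos - rhor) <= rhos * (q * Q).
  by rewrite P1 P2 -mulrA [leRHS]mulrCA ler_pM2l.
apply/andP; split.
(* [q < 2 * P] is s1 < m rewritten. Were it false, the chord inequality would give 2Q(rhos - rhol)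
   <= rhos p, while [kl] and a + b <= 2Q give p(rhos + rhol) <= 2Q(rhos - rhol): impossible, as p
   rhol > 0. *)
- suff : q < 2 * P by rewrite /q /P /a /b; lra.
  rewrite ltNge; apply/negP => qP.
  have H1 : 2 * Q * (rhos - rhol) <= rhos * p.
    rewrite -(ler_pM2r P0).
    have : 0 <= (q - 2 * P) * (Q * (rhos - rhol)).
      by apply: mulr_ge0; [lra|apply: mulr_ge0; [exact: ltW|lra]].
    lra.
  have : (a + b) * (rhos - rhol) <= 2 * Q * (rhos - rhol).
    by rewrite ler_pM2r ?subr_gt0// /Q; move: qP; rewrite /P; lra.
  have := mulr_gt0 p_gt0 rhol_gt0.
  lra.
(* The same argument with the two shocks exchanged: [p < 2 * Q] is m < s2. *)
- suff : p < 2 * Q by rewrite /p /Q /c /d; lra.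
  rewrite ltNge; apply/negP => pQ.
  have H1 : 2 * P * (rhos - rhor) <= rhos * q.
    rewrite -(ler_pM2r Q0).
    have : 0 <= (p - 2 * Q) * (P * (rhos - rhor)).
      by apply: mulr_ge0; [lra|apply: mulr_ge0; [exact: ltW|lra]].
    lra.
  have : (c + d) * (rhos - rhor) <= 2 * P * (rhos - rhor).
    by rewrite ler_pM2r ?subr_gt0// /P; move: pQ; rewrite /Q; lra.
  have := mulr_gt0 q_gt0 rhor_gt0.
  lra.
Qed.

(** As b, c > 0, each velocity jump (a - b or d - c) is at most the sum a + b or c + d, so the
    momentum relations bound its square by the flux jump times 2 eps; then (p + q)^2 <= 2p^2 + 2q^2.
    The extra [ul - ur] on the right stems from the [- eps] in the 2-shock relation. *)
Lemma lax_two_shock_flux_ge :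
    0 < eps -> 0 < rhol -> 0 < rhor -> 0 < rhos ->
    lax_1shock f eps s1 ul rhol us rhos ->
    lax_2shock f eps s2 us rhos ur rhor ->
  (ul - ur) ^+ 2 <= 4 * eps * (2 * f rhos - f rhol - f rhor + (ul - ur)).
Proof.
move=> eps_gt0 rhol_gt0 rhor_gt0 rhos_gt0.
move=> /lax_1shock_compressive[]// M1 P1 b0 p0 lr1.
move=> /lax_2shock_compressive[]// M2 P2 c0 q0 lr2.
have H1 : (ul - us) ^+ 2 <= 2 * eps * (f rhos - f rhol) by nra.
have H2 : (us - ur) ^+ 2 <= 2 * eps * (f rhos - f rhor) + 2 * eps * (ul - ur).
  by nra.
have : 0 <= ((ul - us) - (us - ur)) ^+ 2 by exact: sqr_ge0.
nra.
Qed.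

(** Sum of the two mass balances, in which [us] cancels; the left side is the rate at which mass
    gathers between the shocks. *)
Lemma lax_two_shock_mass :
    0 < eps -> 0 < rhol -> 0 < rhor -> 0 < rhos ->
    lax_1shock f eps s1 ul rhol us rhos ->
    lax_2shock f eps s2 us rhos ur rhor ->
  rhos * (s2 - s1) = rhol * (ul - s1 - eps) + rhor * (s2 + eps - ur).
Proof.
move=> eps_gt0 rhol_gt0 rhor_gt0 rhos_gt0.
move=> /lax_1shock_compressive[]// M1 _ _ _ _.
by move=> /lax_2shock_compressive[]// M2 _ _ _ _; nra.
Qed.

Lemma lax_two_shock_state_bounds :
    0 < eps -> 0 < rhol -> 0 < rhor -> 0 < rhos ->
    lax_1shock f eps s1 ul rhol us rhos ->
    lax_2shock f eps s2 us rhos ur rhor ->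
  s1 + eps < us < s2 + eps.
Proof.
move=> eps_gt0 rhol_gt0 rhor_gt0 rhos_gt0.
move=> /lax_1shock_compressive[]// _ _ b0 _ _.
by move=> /lax_2shock_compressive[]// _ _ c0 _ _; lra.
Qed.

End ShockAlgebra.

(** * Asymptotics of the intermediate state and the shock speeds as [eps] tends to 0 *)

Section ShockLimits.
Context {R : realType}.
Variables (f : R -> R) (ul ur rhol rhor : R).
Hypothesis f_C2 : C2_on_pos f.
Hypothesis f_incr : forall r : R, 0 < r -> 0 < f^`()%classic r.
Hypothesis f_convex : forall r : R, 0 < r -> 0 < f^`(2)%classic r.
Hypotheses (rhol_gt0 : 0 < rhol) (rhor_gt0 : 0 < rhor) (ur_lt_ul : ur < ul).

(** If rhos <= M, then f(rhos) <= f(M), and [lax_two_shock_flux_ge] would bound [eps] below by (ul -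
    ur)^2 / (4C). *)
Lemma lax_two_shock_density_large (M : R) : 0 < M ->
  \forall eps \near 0^'+, forall us rhos s1 s2 : R, 0 < rhos ->
    lax_1shock f eps s1 ul rhol us rhos ->
    lax_2shock f eps s2 us rhos ur rhor -> M < rhos.
Proof.
move=> M0; set C := `|2 * f M - f rhol - f rhor + (ul - ur)| + 1.
have C0 : 0 < C by rewrite ltr_wpDl.
have D0 : 0 < (ul - ur) ^+ 2 by rewrite exprn_gt0// subr_gt0.
near=> eps => us rhos s1 s2 rhos0 L1 L2.
have eps0 : 0 < eps by near: eps; exact: nbhs_right_gt.
have : eps < (ul - ur) ^+ 2 / (4 * C).
  by near: eps; apply: nbhs_right_lt; rewrite divr_gt0// mulr_gt0.
rewrite ltr_pdivlMr ?mulr_gt0// => epsC.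
rewrite ltNge; apply/negP => rhosM.
have := lax_two_shock_flux_ge f_C2 f_incr f_convex eps0 rhol_gt0 rhor_gt0 rhos0 L1 L2.
apply/negP; rewrite -ltNge; apply: le_lt_trans epsC.
rewrite [4 * eps]mulrC -!mulrA ler_pM2l// ler_pM2l//.
have := flux_le f_C2 f_incr rhos0 rhosM.
have := ler_norm (2 * f M - f rhol - f rhor + (ul - ur)).
rewrite /C; lra.
Unshelve. all: by end_near. Qed.

Lemma lax_two_shock_limit (e : R) : 0 < e ->
  \forall eps \near 0^'+, forall us rhos s1 s2 : R, 0 < rhos ->
    lax_1shock f eps s1 ul rhol us rhos ->
    lax_2shock f eps s2 us rhos ur rhor ->
  [/\ s1 < limit_speed ul ur < s2, `|us - limit_speed ul ur| < e,
      s2 - s1 < e &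
      `|rhos * (s2 - s1) - (ul - ur) * ((rhol + rhor) / 2)| < e].
Proof.
move=> e0; set K := rhol + rhor; set D := ul - ur.
have K0 : 0 < K by rewrite addr_gt0.
have D0 : 0 < D by rewrite subr_gt0.
(* [d] will bound both [w] and [eps], and both 2d and 2Kd are below [e]. [M] is chosen so that (rhos
   - K) w <= K (D/2 + 1) with M < rhos forces w < d. *)
set d := e / (2 * (K + 1)).
have dE : d * (2 * (K + 1)) = e by rewrite divfK// gt_eqF//; lra.
have d0 : 0 < d by rewrite divr_gt0//; lra.
set M := K + K * (D / 2 + 1) / d.
have M0 : 0 < M by rewrite addr_gt0// divr_gt0// mulr_gt0//; lra.
near=> eps.
have dens : forall us rhos s1 s2 : R, 0 < rhos ->
    lax_1shock f eps s1 ul rhol us rhos ->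
    lax_2shock f eps s2 us rhos ur rhor -> M < rhos.
  by near: eps; exact: lax_two_shock_density_large.
move=> us rhos s1 s2 rhos0 L1 L2.
have eps0 : 0 < eps by near: eps; exact: nbhs_right_gt.
have eps1 : eps < 1 by near: eps; exact: nbhs_right_lt.
have epsd : eps < d by near: eps; exact: nbhs_right_lt.
have Mrhos := dens _ _ _ _ rhos0 L1 L2.
have enc := lax_two_shock_enclose f_C2 f_incr f_convex eps0 rhol_gt0 rhor_gt0
  rhos0 L1 L2.
have mass := lax_two_shock_mass f_C2 f_incr f_convex eps0 rhol_gt0 rhor_gt0
  rhos0 L1 L2.
have bnd := lax_two_shock_state_bounds f_C2 f_incr f_convex eps0 rhol_gt0 rhor_gt0
  rhos0 L1 L2.
have /andP[s1m ms2] := enc; have /andP[us1 us2] := bnd.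
set w := s2 - s1 in mass *.
have w0 : 0 < w by rewrite subr_gt0 (lt_trans s1m).
move: s1m ms2; rewrite /limit_speed => s1m ms2.
(* As m lies between the shock speeds, both relative speeds in [mass] are within w + eps of D/2,
   which pins [rhos * w] to D K/2 up to K (w + eps). *)
have aP : 0 < (ul - s1 - eps - (D / 2 - eps)) by rewrite /D; lra.
have aP' : 0 < D / 2 + w - (ul - s1 - eps) by rewrite /D /w; lra.
have dP : 0 < (s2 + eps - ur) - (D / 2 + eps) by rewrite /D; lra.
have dP' : 0 < D / 2 + w + eps - (s2 + eps - ur) by rewrite /D /w; lra.
have := mulr_gt0 rhol_gt0 aP; have := mulr_gt0 rhol_gt0 aP'.
have := mulr_gt0 rhor_gt0 dP; have := mulr_gt0 rhor_gt0 dP'.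
have := mulr_gt0 rhol_gt0 eps0; have := mulr_gt0 rhor_gt0 eps0 => re le p1 p2 p3 p4.
have lw := mulr_gt0 rhol_gt0 w0; have rw := mulr_gt0 rhor_gt0 w0.
have up : rhos * w - D * (K / 2) < K * (w + eps) by rewrite mass /K; lra.
have lo : - (K * (w + eps)) < rhos * w - D * (K / 2) by rewrite mass /K; lra.
have wd : w < d.
  have : K * (D / 2 + 1) < (rhos - K) * d.
    by rewrite -ltr_pdivrMr// ltrBrDl.
  have : (rhos - K) * w <= K * (D / 2 + 1) by nra.
  have rK : 0 < rhos - K.
    rewrite subr_gt0 (lt_trans _ Mrhos)// /M ltrDl divr_gt0// mulr_gt0//; lra.
  move=> h1 h2; rewrite -(ltr_pM2l rK); exact: le_lt_trans h2.
have KK : K * (w + eps) < e.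
  by rewrite -dE; have : 0 < K * ((d - w) + (d - eps)); [rewrite mulr_gt0//|]; lra.
have we : w + eps < e.
  by rewrite -dE; have : 0 < K * d; [rewrite mulr_gt0//|]; lra.
split => //.
(* Both us - eps and the limit speed lie between s1 and s2, so [us] is within w + eps of the limit
   speed. *)
- rewrite ltr_norml /limit_speed; apply/andP; move: us1 us2 we; rewrite /w; split; lra.
- by lra.
- by rewrite ltr_norml; apply/andP; split; lra.
Unshelve. all: by end_near. Qed.

End ShockLimits.

(** * Borel measurability and integrability for the product measure *)

Section PlaneMeasurability.
Context {R : realType}.

Notation plane := (measurableTypeR R * measurableTypeR R)%type.

(** An open set is the union of the countably many rational rectangles it contains, so it lies in
    the product sigma-algebra. *)
Lemma open_measurable_plane (A : set (R * R)) :
  open A -> measurable (A : set plane).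
Proof.
move=> oA.
pose rect (q : rat * rat * rat * rat) : set (R * R) :=
  `]ratr q.1.1.1, ratr q.1.1.2[%classic `*` `]ratr q.1.2, ratr q.2[%classic.
have -> : A = \bigcup_(q in [set q | rect q `<=` A]) rect q.
  apply/seteqP; split=> [[x t] Axt|p [q qA qp]]; last exact: qA.
  have /nbhs_ballP[e /= e0 eA] : nbhs (x, t) A by apply: open_nbhs_nbhs.
  have [a aq] : exists q, ratr q \in `]x - e, x[%R.
    by apply: rat_in_itvoo; rewrite ltrBlDr ltrDl.
  have [b bq] : exists q, ratr q \in `]x, x + e[%R.
    by apply: rat_in_itvoo; rewrite ltrDl.
  have [c cq] : exists q, ratr q \in `]t - e, t[%R.
    by apply: rat_in_itvoo; rewrite ltrBlDr ltrDl.
  have [d dq] : exists q, ratr q \in `]t, t + e[%R.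
    by apply: rat_in_itvoo; rewrite ltrDl.
  move: aq bq cq dq; rewrite !in_itv/=.
  move=> /andP[a1 a2] /andP[b1 b2] /andP[c1 c2] /andP[d1 d2].
  exists (a, b, c, d); last by split; rewrite /= in_itv/=; apply/andP.
  move=> [y s] []; rewrite /= !in_itv/= => /andP[y1 y2] /andP[s1 s2]; apply: eA.
  by split; rewrite /ball/= ltr_norml; apply/andP; split; lra.
have mrect q : measurable (rect q : set plane).
  by apply: measurableX; exact: measurable_itv.
rewrite bigcup_mkcond.
apply: countable_bigcupT_measurable => // q; case: ifPn => // _; exact: mrect.
Qed.

Lemma continuous_measurable_plane (phi : R * R -> R) :
  continuous phi -> measurable_fun (setT : set plane) phi.
Proof.
move=> /continuousP cphi.
apply: (measurability _ (RGenOpens.measurableE R)) => _ [_ [a [b ->] <-]].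
by rewrite setTI; apply: open_measurable_plane; apply: cphi; exact: interval_open.
Qed.

Lemma upper_half_plane_measurable : measurable (@upper_half_plane R : set plane).
Proof.
apply: open_measurable_plane; rewrite /upper_half_plane.
have -> : [set p : R * R | 0 < p.2] = snd @^-1` `]0, +oo[%classic.
  by apply/seteqP; split => p /=; rewrite in_itv/= andbT.
apply: open_comp; last exact: interval_open.
by move=> p _; exact: cvg_snd.
Qed.
End PlaneMeasurability.

Lemma integrable_bounded_support d (T : measurableType d) (R : realType)
    (mu : {measure set T -> \bar R}) (A B : set T) (g : T -> R) (C : R) :
    measurable A -> measurable B -> (mu B < +oo)%E -> measurable_fun A g ->
    (forall x, A x -> `|g x| <= C) -> (forall x, A x -> g x != 0 -> B x) ->
  mu.-integrable A (EFin \o g).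
Proof.
move=> mA mB muB mg gC gB.
have /(integrable_restrict mu mB mA) : mu.-integrable (A `&` B) (EFin \o g).
  apply: measurable_bounded_integrable; first exact: measurableI.
  - apply: le_lt_trans muB; apply: le_measure; rewrite ?inE//.
    exact: measurableI.
  - exact: measurable_funS mg.
  - exists C; split; first exact: num_real.
    by move=> M CM x [Ax _]; exact: le_trans (gC x Ax) (ltW CM).
apply: eq_integrable => // x /set_mem Ax; rewrite patchE.
case: ifPn => // /negP xB; have [gx0|/(gB _ Ax) Bx] := eqVneq (g x) 0; first by rewrite /= gx0.
by exfalso; apply: xB; rewrite inE.
Qed.

(** * Uniform continuity, support and bounds of test functions *)

Section TestFunctions.
Context {R : realType}.

(** Compactness, as a near-covering property, gives one radius for all p in the support and
    arbitrary q. If phi p = 0, either phi q = 0 too or p and q are exchanged. *)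
Lemma compact_support_unif_continuous (phi : R * R -> R) (e : R) :
    continuous phi -> compact (closure [set p | phi p != 0]) -> 0 < e ->
  exists2 d : R, 0 < d & forall p q, ball p d q -> `|phi p - phi q| < e.
Proof.
move=> cphi cK e0; set K := closure _ in cK.
have /compact_near_coveringP cov := cK.
have : \forall d \near (0 : R)^'+,
    K `<=` (fun p => forall q, ball p d q -> `|phi p - phi q| < e).
  apply: cov => p Kp.
  have /cvgrPdist_lt/(_ (e / 2)) := cphi p.
  rewrite divr_gt0// => /(_ isT)/nbhs_ballP[r /= r0 pr].
  exists (ball p (r / 2), [set d | d < r / 2]) => /=.
    by split; [apply: nbhsx_ballx; rewrite divr_gt0|
               apply: nbhs_right_lt; rewrite divr_gt0].
  move=> [x d] /= [px dr] q xq.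
  rewrite (splitr e) -(subrK (phi p) (phi x)) -addrA.
  apply: le_lt_trans (ler_normD _ _) _; apply: ltrD.
    rewrite distrC; apply: pr; apply: le_ball px.
    by rewrite ler_pdivrMr// ler_peMr ?(ltW r0)// ler1n.
  apply: pr; rewrite (splitr r); apply: ball_triangle px _.
  exact: le_ball (ltW dr) _ xq.
move=> H; have : \forall d \near (0 : R)^'+, 0 < d /\
    K `<=` (fun p => forall q, ball p d q -> `|phi p - phi q| < e).
  by apply: filterI H; exact: nbhs_right_gt.
move/filter_ex => [d [d0 Kd]]; exists d => // p q pq.
have [p0|p0] := eqVneq (phi p) 0; last by apply: Kd => //; exact: subset_closure.
have [q0|q0] := eqVneq (phi q) 0; first by rewrite p0 q0 subrr normr0.
by rewrite distrC; apply: Kd; [exact: subset_closure|exact: ball_sym].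
Qed.

Lemma test_function_box (phi : R * R -> R) : test_function phi ->
  exists2 T : R, 0 < T & forall p, phi p != 0 -> `|p.1| <= T /\ 0 < p.2 <= T.
Proof.
case=> _ cK sK; have [M [_ KM]] := compact_bounded cK.
exists (`|M| + 1); first by rewrite ltr_wpDl.
move=> p p0; have Kp : closure [set p | phi p != 0] p by exact: subset_closure.
have /= := KM (`|M| + 1) _ p Kp; rewrite ltr_pwDr ?ler_norm// => /(_ isT).
rewrite prod_normE/= ge_max => /andP[p1 p2]; split => //.
have /= -> := sK _ Kp; exact: le_trans (ler_norm _) p2.
Qed.

Lemma test_function_bounded (phi : R * R -> R) : test_function phi ->
  exists2 M : R, 0 < M & forall p, `|phi p| <= M.
Proof.
case=> cphi cK sK; have := cphi 0%N; rewrite /= => {}cphi.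
have /compact_bounded[M [_ KM]] : compact (phi @` closure [set p | phi p != 0]).
  by apply: continuous_compact => //; exact: continuous_subspaceT.
exists (`|M| + 1); first by rewrite ltr_wpDl.
move=> p; have [->|p0] := eqVneq (phi p) 0; first by rewrite normr0 addr_ge0.
apply: KM; first by rewrite ltr_pwDr ?ler_norm.
by exists p => //; exact: subset_closure.
Qed.

End TestFunctions.

(** * Integrals over the strip between two rays *)

Section StripIntegrals.
Context {R : realType}.

Notation plane := (measurableTypeR R * measurableTypeR R)%type.
Notation mu := (@lebesgue_measure R).
Notation mu2 := (mu \x mu)%E.
Notation upper := (@upper_half_plane R).

Definition left_of (s : R) : set (R * R) := [set p | p.1 < s * p.2].
Definition right_of (s : R) : set (R * R) := [set p | s * p.2 < p.1].
(** Closed at both ends, so that [strip s s] is the line x = s t and the complement is a union of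
    two open half-planes. *)
Definition strip (s1 s2 : R) : set (R * R) := [set p | s1 * p.2 <= p.1 <= s2 * p.2].

Let continuous_slope (s : R) : continuous (fun p : R * R => s * p.2 - p.1).
Proof.
move=> p; apply: cvgB; last exact: cvg_fst.
by apply: cvgMr; exact: cvg_snd.
Qed.

Lemma left_of_measurable (s : R) : measurable (left_of s : set plane).
Proof.
apply: open_measurable_plane.
have -> : left_of s = (fun p => s * p.2 - p.1) @^-1` `]0, +oo[%classic.
  by apply/seteqP; split => p /=; rewrite /left_of/= in_itv/= andbT subr_gt0.
by apply: open_comp => [p _|]; [exact: continuous_slope|exact: interval_open].
Qed.

Lemma right_of_measurable (s : R) : measurable (right_of s : set plane).
Proof.
apply: open_measurable_plane.
have -> : right_of s = (fun p => s * p.2 - p.1) @^-1` `]-oo, 0[%classic.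
  by apply/seteqP; split => p /=; rewrite /right_of/= in_itv/= subr_lt0.
by apply: open_comp => [p _|]; [exact: continuous_slope|exact: interval_open].
Qed.

Lemma strip_measurable (s1 s2 : R) : measurable (strip s1 s2 : set plane).
Proof.
have -> : strip s1 s2 = ~` (left_of s1 `|` right_of s2).
  apply/seteqP; split => p; rewrite /strip /left_of /right_of/=.
    by move=> /andP[p1 p2] [|]; rewrite ltNge ?p1 ?p2.
  by move=> /not_orP[/negP + /negP]; rewrite -!leNgt => -> ->.
by apply: measurableC; apply: measurableU;
  [exact: left_of_measurable|exact: right_of_measurable].
Qed.

(** By Tonelli with x integrated first: each horizontal slice is a single point. *)
Lemma ray_null (s : R) : mu2.-negligible (strip s s).
Proof.
exists (strip s s); split => //; first exact: strip_measurable.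
have mS := strip_measurable s s.
have -> : mu2 (strip s s) = (\int[mu2]_p (\1_(strip s s) p)%:E)%E.
  by rewrite integral_indic// setIT.
pose I (p : plane) : \bar R := (\1_(strip s s) p)%:E.
have mI : measurable_fun setT I.
  by apply/measurable_EFinP; exact: measurable_indic.
have I0 (p : plane) : (0 <= I p)%E by rewrite lee_fin.
rewrite (@fubini_tonelli2 _ _ (measurableTypeR R) (measurableTypeR R) R mu mu I mI I0).
apply: integral0_eq => t _; rewrite /fubini_G/=.
transitivity (\int[mu]_x (\1_[set s * t] x)%:E)%E; last first.
  rewrite integral_indic// setIT; exact: lebesgue_measure_set1.
apply: eq_integral => x _; rewrite /I; congr EFin; rewrite !indicE; congr (nat_of_bool _)%:R.
apply/idP/idP; rewrite !inE /strip/=; first by rewrite -eq_le => /eqP.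
by move=> ->; rewrite lexx.
Qed.

Lemma strip_bounded (s1 s2 T : R) : 0 < T -> exists2 L : R, 0 < L &
  forall p, strip s1 s2 p -> 0 < p.2 <= T -> `|p.1| <= L.
Proof.
move=> T0; exists ((`|s1| + `|s2| + 1) * T).
  by rewrite mulr_gt0// ltr_wpDl// addr_ge0.
move=> [x t]; rewrite /strip/= => /andP[sx xs] /andP[t0 tT].
have B s : (s == s1) || (s == s2) -> `|s * t| <= (`|s1| + `|s2| + 1) * T.
  move=> s12; rewrite normrM (gtr0_norm t0); apply: ler_pM => //; first exact: ltW.
  by case/orP : s12 => /eqP ->; have := normr_ge0 s1; have := normr_ge0 s2; lra.
have := B s1; rewrite eqxx => /(_ isT); have := B s2; rewrite eqxx orbT => /(_ isT).
rewrite !ler_norml => /andP[_ H2] /andP[H1 _].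
by apply/andP; split; [exact: le_trans sx|exact: le_trans H2].
Qed.

Let box (L T : R) : set plane := `[- L, L]%classic `*` `[0, T]%classic.

Let box_measurable (L T : R) : measurable (box L T).
Proof. by apply: measurableX; exact: measurable_itv. Qed.

Let segment_finite (a b : R) : (mu `[a, b]%classic < +oo)%E.
Proof.
by rewrite lebesgue_measure_itv/=; case: ifP => _; rewrite -?EFinB ltry.
Qed.

Let box_finite (L T : R) : (mu2 (box L T) < +oo)%E.
Proof.
rewrite /box product_measure1E; [|exact: measurable_itv..].
by apply: lte_mul_pinfty; rewrite ?ge0_fin_numE//; exact: segment_finite.
Qed.

Lemma integrable_plane (A : set plane) (g : R * R -> R) (C L T : R) :
    measurable A -> measurable_fun A (g : plane -> R) ->
    (forall p, A p -> `|g p| <= C) ->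
    (forall p, A p -> g p != 0 -> `|p.1| <= L /\ 0 < p.2 <= T) ->
  mu2.-integrable A (EFin \o g).
Proof.
move=> mA mg gC gLT.
apply: (integrable_bounded_support mA (box_measurable L T) (box_finite L T) mg gC).
move=> p Ap p0; have [p1 /andP[p2 p3]] := gLT p Ap p0.
by split; rewrite /= in_itv/= ?(ltW p2)//; rewrite -ler_norml.
Qed.

Lemma Rintegral_support d (X : measurableType d) (nu : {measure set X -> \bar R})
    (A : set X) (g : X -> R) : (forall x, ~ A x -> g x = 0) ->
  \int[nu]_(x in A) g x = \int[nu]_x g x.
Proof.
move=> gA; rewrite Rintegral_mkcond; congr Rintegral; apply/funext => x.
by rewrite patchE; case: ifPn => // /negP Ax; rewrite gA// => ?; apply: Ax; rewrite inE.
Qed.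

Lemma integrable_first_moment (h : R -> R) (M T : R) :
    measurable_fun setT h -> (forall t, `|h t| <= M) ->
    (forall t, h t != 0 -> 0 < t <= T) ->
  mu.-integrable setT (EFin \o (fun t => t * h t)).
Proof.
move=> mh hM hT.
apply: (@integrable_bounded_support _ (measurableTypeR R) R mu setT `[0, T]%classic
  (fun t => t * h t) (`|T| * M)) => //.
- exact: segment_finite.
- by apply: measurable_funM => //; exact: measurable_id.
- move=> t _; have [->|/hT /andP[t0 tT]] := eqVneq (h t) 0.
    by rewrite mulr0 normr0 mulr_ge0//; exact: le_trans (hM 0).
  rewrite normrM ler_pM// gtr0_norm// (le_trans tT)//; exact: ler_norm.
- move=> t _; rewrite mulf_eq0 negb_or => /andP[_ /hT /andP[t0 tT]].
  by rewrite /= in_itv/= ltW.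
Qed.

Lemma strip_integrable (s1 s2 : R) (h : R -> R) (M T : R) : 0 < T ->
    measurable_fun setT h -> (forall t, `|h t| <= M) ->
    (forall t, h t != 0 -> 0 < t <= T) ->
  mu2.-integrable setT (EFin \o (fun p => \1_(strip s1 s2) p * h p.2)).
Proof.
move=> T0 mh hM hT; have [L L0 SL] := strip_bounded s1 s2 T0.
apply: (@integrable_plane _ _ M L T) => //.
- apply: measurable_funM.
    by apply: measurable_indic; exact: strip_measurable.
  by apply: (measurableT_comp mh); exact: measurable_snd.
- move=> p _; apply: le_trans (hM p.2); rewrite normrM ler_piMl// indicE.
  by case: (_ \in _); rewrite ?normr1 ?normr0.
- move=> p _; rewrite mulf_eq0 negb_or => /andP[+ /hT pT].
  rewrite indicE pnatr_eq0 eqb0 negbK inE => Sp.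
  by split => //; exact: SL.
Qed.

(** By Fubini: the slice at height t > 0 has length (s2 - s1) t, the source of the factor t in the
    delta weight. *)
Lemma strip_integral (s1 s2 : R) (h : R -> R) (M T : R) : 0 < T -> s1 < s2 ->
    measurable_fun setT h -> (forall t, `|h t| <= M) ->
    (forall t, h t != 0 -> 0 < t <= T) ->
  \int[mu2]_(p in upper) (\1_(strip s1 s2) p * h p.2) =
  (s2 - s1) * \int[mu]_(t in `]0, +oo[) (t * h t).
Proof.
move=> T0 s12 mh hM hT.
have h0 t : ~ 0 < t -> h t = 0.
  by move=> t0; apply/eqP; apply: contrapT => /negP/hT/andP[].
rewrite (@Rintegral_support _ plane mu2 upper); last first.
  by move=> p p2; rewrite h0 ?mulr0.
rewrite (@Rintegral_support _ (measurableTypeR R) mu `]0, +oo[%classic); last first.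
  by move=> t; rewrite /= in_itv/= andbT => t0; rewrite h0 ?mulr0.
rewrite -RintegralZl//; last exact: integrable_first_moment hT.
rewrite /Rintegral.
rewrite -(integral21_prod_meas1 (strip_integrable s1 s2 T0 mh hM hT))/=.
congr fine; apply: eq_integral => t _; rewrite /fubini_G/=.
have [t0|t0] := ltP 0 t; last first.
  rewrite h0 ?mulr0; last by apply/negP; rewrite -leNgt.
  by apply: integral0_eq => x _; rewrite mulr0.
transitivity (\int[mu]_x ((h t)%:E * (\1_(`[s1 * t, s2 * t]%classic) x)%:E))%E.
  by apply: eq_integral => x _; rewrite -EFinM mulrC; congr (_ * _)%:E.
rewrite integralZl//; last exact: integrable_indic_itv.
rewrite integral_indic// setIT.
transitivity ((h t)%:E * ((s2 - s1) * t)%:E)%E; last first.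
  by rewrite -EFinM; congr EFin; ring.
congr (_ * _)%E; apply: etrans (lebesgue_measure_itv _) _.
by rewrite /= lte_fin ltr_pM2r// s12 -EFinB -mulrBl.
Qed.

End StripIntegrals.

(** * Comparison of the two-shock density with its limit at fixed [eps] *)

Section StripPerturbation.
Context {R : realType}.

Notation plane := (measurableTypeR R * measurableTypeR R)%type.
Notation mu := (@lebesgue_measure R).
Notation mu2 := (mu \x mu)%E.
Notation upper := (@upper_half_plane R).

Lemma regular_distribution_indic (s c : R) (A : set (R * R)) (phi : R * R -> R) :
    measurable (A : set plane) ->
  regular_distribution A (cst c) phi = \int[mu2]_(p in upper) (c * \1_A p * phi p).
Proof.
move=> mA; rewrite /regular_distribution Rintegral_mkcondl.
apply: eq_Rintegral => p _; rewrite patchE indicE.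
by case: ifPn => /=; rewrite ?mulr1 ?mulr0 ?mul0r.
Qed.

(** Off the shock rays, rho phi = rho0 phi + rhos 1_strip h + E, where rho0 is the two-state density
    cut along x = m t and h(t) = phi(m t, t). The error E lives on the strip and is at most rhos eta
    + (rhol + rhor) M. *)
Lemma strip_perturbation (m rhol rhor rhos s1 s2 T M eta : R)
    (rho phi : R * R -> R) :
    0 <= rhol -> 0 <= rhor -> 0 <= rhos -> s1 < m < s2 -> 0 < T ->
    measurable_fun (upper : set plane) (rho : plane -> R) ->
    (forall x t, 0 < t -> [/\ x < s1 * t -> rho (x, t) = rhol,
       s1 * t < x < s2 * t -> rho (x, t) = rhos &
       s2 * t < x -> rho (x, t) = rhor]) ->
    continuous phi ->
    (forall p, phi p != 0 -> `|p.1| <= T /\ 0 < p.2 <= T) ->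
    (forall p, `|phi p| <= M) ->
    (forall x t, 0 < t <= T -> s1 * t <= x <= s2 * t ->
       `|phi (x, t) - phi (m * t, t)| <= eta) ->
  `|regular_distribution setT rho phi -
    (regular_distribution (left_of m) (cst rhol) phi +
     regular_distribution (right_of m) (cst rhor) phi) -
    rhos * (s2 - s1) * \int[mu]_(t in `]0, +oo[) (t * phi (m * t, t))| <=
  (rhos * eta + (rhol + rhor) * M) *
    ((s2 - s1) * \int[mu]_(t in `]0, +oo[) (t * \1_`]0, T] t)).
Proof.
move=> rl0 rr0 rs0 /andP[s1m ms2] T0 mrho rhoE cphi phiT phiM phieta.
have M0 : 0 <= M by exact: le_trans (phiM 0).
have s12 := lt_trans s1m ms2.
have mphi := continuous_measurable_plane cphi.
have mupper := @upper_half_plane_measurable R.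
have mS := strip_measurable s1 s2.
have mL := left_of_measurable m; have mR := right_of_measurable m.
pose h t := phi (m * t, t).
(* The strip is unbounded in t; the cutoff [k] makes the bound on [E] integrable. *)
pose k : R -> R := \1_`]0, T]%classic.
have ch : continuous h.
  move=> t; apply: (@continuous_comp _ _ _ (fun t => (m * t, t)) phi); last exact: cphi.
  have mt : m * x @[x --> t] --> m * t by apply: cvgMr; exact: cvg_id.
  exact: cvg_pair mt cvg_id.
have mh : measurable_fun setT h by exact: continuous_measurable_fun.
have mk : measurable_fun setT k by apply: measurable_indic; exact: measurable_itv.
have hM t : `|h t| <= M by exact: phiM.
have hT t : h t != 0 -> 0 < t <= T by move=> /phiT[].
have k1 t : `|k t| <= 1.
  by rewrite /k indicE; case: (_ \in _); rewrite ?normr1 ?normr0.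
have kT t : k t != 0 -> 0 < t <= T.
  by rewrite /k indicE pnatr_eq0 eqb0 negbK inE /= in_itv.
have kE t : 0 < t <= T -> k t = 1.
  by move=> tT; rewrite /k indicE mem_set// /= in_itv.
pose rho0 (p : plane) : R := rhol * \1_(left_of m) p + rhor * \1_(right_of m) p.
have mrho0 : measurable_fun setT rho0.
  by rewrite /rho0; apply: measurable_funD; apply: measurable_funM => //;
    exact: measurable_indic.
have rho0_le p : `|rho0 p| <= rhol + rhor.
  rewrite /rho0 !indicE; apply: le_trans (ler_normD _ _) _.
  by apply: lerD; rewrite normrM (ger0_norm (_ : 0 <= _))// ler_piMr//;
    case: (_ \in _); rewrite ?normr1 ?normr0.
pose E (p : plane) : R :=
  \1_(strip s1 s2) p * (rhos * (phi p - h p.2) - rho0 p * phi p).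
set C := rhos * eta + (rhol + rhor) * M.
have E_le (p : plane) : upper p -> `|E p| <= C * (\1_(strip s1 s2) p * k p.2).
  case: p => x t /= t0; rewrite /E indicE.
  have [|_] := boolP ((x, t) \in _); last by rewrite !mul0r mulr0 normr0.
  rewrite inE !mul1r => Sp; have [tT|tT] := leP t T; last first.
    have p0 y : phi (y, t) = 0.
      apply/eqP; apply: contrapT => /negP/phiT[_ /andP[_]].
      by rewrite leNgt tT.
    rewrite /h !p0 subrr !mulr0 subrr normr0 mulr_ge0//.
      rewrite /C addr_ge0// mulr_ge0 ?addr_ge0//.
      (* The bound 0 <= eta is read off the oscillation estimate at (m T, T), a point of the
         strip. *)
      have tT' : 0 < T <= T by rewrite T0 lexx.
      apply: le_trans (phieta (m * T) T tT' _); first exact: normr_ge0.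
      by rewrite !ler_pM2r// !ltW.
  have tT' : 0 < t <= T by rewrite t0.
  rewrite kE// mulr1; apply: le_trans (ler_normB _ _) _; apply: lerD.
    rewrite normrM (ger0_norm rs0); apply: ler_wpM2l => //; exact: phieta.
  by rewrite normrM ler_pM.
have mE : measurable_fun setT E.
  apply: measurable_funM; first exact: measurable_indic.
  apply: measurable_funB; last exact: measurable_funM.
  apply: measurable_funM => //; apply: measurable_funB => //.
  by apply: (measurableT_comp mh); exact: measurable_snd.
have iSk : mu2.-integrable upper (EFin \o (fun p => \1_(strip s1 s2) p * k p.2)).
  by apply: integrableS (strip_integrable s1 s2 T0 mk k1 kT).
have iSh : mu2.-integrable upper (EFin \o (fun p => \1_(strip s1 s2) p * h p.2)).
  by apply: integrableS (strip_integrable s1 s2 T0 mh hM hT).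
have iCSk : mu2.-integrable upper
    (EFin \o (fun p => C * (\1_(strip s1 s2) p * k p.2))).
  by have := integrableZl mupper C iSk; apply: eq_integrable.
have iRSh : mu2.-integrable upper
    (EFin \o (fun p => rhos * (\1_(strip s1 s2) p * h p.2))).
  by have := integrableZl mupper rhos iSh; apply: eq_integrable.
have iE : mu2.-integrable upper (EFin \o E).
  apply: le_integrable iCSk => //.
    by apply/measurable_EFinP; exact: measurable_funTS.
  move=> p p0; rewrite /= lee_fin; apply: le_trans (E_le p p0) _; exact: ler_norm.
have iL (c : R) (A : set plane) : measurable A ->
    mu2.-integrable upper (EFin \o (fun p => c * \1_A p * phi p)).
  move=> mA; apply: (@integrable_plane _ _ _ (`|c| * M) T T) => //.
  - apply: measurable_funTS; apply: measurable_funM => //.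
    by apply: measurable_funM => //; exact: measurable_indic.
  - move=> p _; rewrite normrM ler_pM// normrM ler_piMr// indicE.
    by case: (_ \in _); rewrite ?normr1 ?normr0.
  - by move=> p _; rewrite mulf_eq0 negb_or => /andP[_ /phiT].
have irho0 : mu2.-integrable upper (EFin \o (fun p => rho0 p * phi p)).
  have := integrableD mupper (iL rhol _ mL) (iL rhor _ mR).
  by apply: eq_integrable => // p _; rewrite /= -EFinD -mulrDl.
have irest : mu2.-integrable upper
    (EFin \o (fun p => rhos * (\1_(strip s1 s2) p * h p.2) + E p)).
  exact: integrableD iRSh iE.
have -> : regular_distribution setT rho phi = \int[mu2]_(p in upper)
    (rho0 p * phi p + (rhos * (\1_(strip s1 s2) p * h p.2) + E p)).
  rewrite /regular_distribution setTI; congr fine; apply: ae_eq_integral => //.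
  - apply/measurable_EFinP; apply: measurable_funM => //.
    exact: measurable_funTS.
  - exact: measurable_int (integrableD mupper irho0 irest).
  (* On the two rays [rho] is unspecified, so the decomposition holds almost everywhere only. *)
  have N : mu2.-negligible (strip s1 s1 `|` strip s2 s2).
    by apply: negligibleU; exact: ray_null.
  apply: negligibleS N.
  move=> [x t]; apply: contra_notP => /not_orP[n1 n2] /= t0; congr EFin.
  have [rL rS rR] := rhoE x t t0.
  have xs1 : x != s1 * t by apply/eqP => xE; apply: n1; rewrite /strip/= xE lexx.
  have xs2 : x != s2 * t by apply/eqP => xE; apply: n2; rewrite /strip/= xE lexx.
  have s1mt : s1 * t < m * t by rewrite ltr_pM2r.
  have ms2t : m * t < s2 * t by rewrite ltr_pM2r.
  have memE (P : bool) (A : set (R * R)) : A (x, t) <-> P -> ((x, t) \in A) = P.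
    by move=> AP; apply/idP/idP => [/set_mem/AP|/AP/mem_set].
  rewrite /E /rho0 !indicE (memE (x < m * t) (left_of m))//.
  rewrite (memE (m * t < x) (right_of m))//.
  rewrite (memE (s1 * t <= x <= s2 * t) (strip s1 s2))//.
  have [x1|x1|x1] := ltgtP x (s1 * t); last by rewrite x1 eqxx in xs1.
    rewrite rL// (lt_trans x1 s1mt) (lt_gtF (lt_trans x1 s1mt))/=.
    by rewrite !(mulr1, mulr0, mul0r, addr0).
  have [x2|x2|x2] := ltgtP x (s2 * t); last by rewrite x2 eqxx in xs2.
    rewrite rS ?x1//= !mul1r mulrBr.
    by rewrite [RHS]addrC -[RHS]addrA subrK [RHS]addrC subrK.
  rewrite rR//= (lt_trans ms2t x2) (lt_gtF (lt_trans ms2t x2)).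
  by rewrite !(mulr1, mulr0, mul0r, addr0, add0r).
rewrite RintegralD// RintegralD// RintegralZl//.
rewrite (strip_integral T0 s12 mh hM hT).
rewrite !regular_distribution_indic// -RintegralD//; [|exact: iL..].
have -> : \int[mu2]_(p in upper) (rho0 p * phi p) = \int[mu2]_(p in upper)
    (rhol * \1_(left_of m) p * phi p + rhor * \1_(right_of m) p * phi p).
  by apply: eq_Rintegral => p _; rewrite -mulrDl.
rewrite -(strip_integral T0 s12 mk k1 kT) -[C * _]RintegralZl//.
have cancel (i j x : R) : i + (j + x) - i - j = x by ring.
rewrite [X in `|X|](_ : _ = \int[mu2]_(p in upper) E p); last first.
  by rewrite mulrA; exact: cancel.
apply: le_trans (le_normr_Rintegral mupper iE) _.
apply: le_Rintegral => //.
by have := integrable_norm iE.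
Qed.

End StripPerturbation.

(** * Passage to the limit *)

Section Conclusion.
Context {R : realType}.
Variables (f : R -> R) (ul ur rhol rhor : R) (u rho : R -> R * R -> R).
Hypothesis f_C2 : C2_on_pos f.
Hypothesis f_incr : forall r : R, 0 < r -> 0 < f^`()%classic r.
Hypothesis f_convex : forall r : R, 0 < r -> 0 < f^`(2)%classic r.
Hypotheses (rhol_gt0 : 0 < rhol) (rhor_gt0 : 0 < rhor) (ur_lt_ul : ur < ul).
Hypothesis two_shocks : \forall eps \near (0 : R)^'+,
  lax_two_shock_solution f eps ul rhol ur rhor (u eps) (rho eps).

Notation mu := (@lebesgue_measure R).
Notation m := (limit_speed ul ur).
Notation mass := ((ul - ur) * ((rhol + rhor) / 2)).

(** Collects all that both limits use of the shock structure; [f] no longer appears. *)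
Lemma two_shocks_near (e : R) : 0 < e -> \forall eps \near (0 : R)^'+,
  measurable_fun (@upper_half_plane R) (rho eps) /\
  exists us rhos s1 s2 : R,
    [/\ 0 < rhos, s1 < m < s2, `|us - m| < e, s2 - s1 < e &
        `|rhos * (s2 - s1) - mass| < e] /\
    forall x t : R, 0 < t ->
      [/\ x < s1 * t -> u eps (x, t) = ul /\ rho eps (x, t) = rhol,
          s1 * t < x < s2 * t -> u eps (x, t) = us /\ rho eps (x, t) = rhos &
          s2 * t < x -> u eps (x, t) = ur /\ rho eps (x, t) = rhor].
Proof.
move=> e0; near=> eps.
have lim : forall us rhos s1 s2 : R, 0 < rhos ->
    lax_1shock f eps s1 ul rhol us rhos ->
    lax_2shock f eps s2 us rhos ur rhor ->
  [/\ s1 < m < s2, `|us - m| < e, s2 - s1 < e & `|rhos * (s2 - s1) - mass| < e].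
  by near: eps; exact: lax_two_shock_limit.
have [_ [mrho [us [rhos [s1 [s2 [rhos0 L1 L2 sol]]]]]]] :
    lax_two_shock_solution f eps ul rhol ur rhor (u eps) (rho eps) by near: eps.
split => //; exists us, rhos, s1, s2; split => //.
by have [] := lim _ _ _ _ rhos0 L1 L2.
Unshelve. all: by end_near. Qed.

(** Off the limit line, once s2 - s1 is below |x/t - m| the point lies outside the strip and [u] is
    constant in [eps]. On the line, the enclosure s1 < m < s2 gives the value [us], which tends to
    m. *)
Lemma pointwise_limit_u (x t : R) : 0 < t ->
  u eps (x, t) @[eps --> (0 : R)^'+] --> limit_u ul ur x t.
Proof.
move=> t0; apply/cvgrPdist_lt => e e0; rewrite /limit_u.
have [xm|xm|->] := ltgtP x (m * t).
- have d0 : 0 < m - x / t by rewrite subr_gt0 ltr_pdivrMr.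
  apply: filterS (two_shocks_near d0) => eps.
  move=> [_ [us [rhos [s1 [s2 [[_ /andP[s1m ms2] _ s12 _] sol]]]]]].
  have xs1 : x < s1 * t by rewrite -ltr_pdivrMr//; lra.
  by have [/(_ xs1)[-> _] _ _] := sol x t t0; rewrite subrr normr0.
- have d0 : 0 < x / t - m by rewrite subr_gt0 ltr_pdivlMr.
  apply: filterS (two_shocks_near d0) => eps.
  move=> [_ [us [rhos [s1 [s2 [[_ /andP[s1m ms2] _ s12 _] sol]]]]]].
  have s2x : s2 * t < x by rewrite -ltr_pdivlMr//; lra.
  by have [_ _ /(_ s2x)[-> _]] := sol x t t0; rewrite subrr normr0.
- apply: filterS (two_shocks_near e0) => eps.
  move=> [_ [us [rhos [s1 [s2 [[_ /andP[s1m ms2] use _ _] sol]]]]]].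
  have smid : s1 * t < m * t < s2 * t by rewrite !ltr_pM2r// s1m.
  by have [_ /(_ smid)[-> _] _] := sol (m * t) t t0; rewrite distrC.
Qed.

Lemma distributional_limit_rho (phi : R * R -> R) : test_function phi ->
  regular_distribution setT (rho eps) phi @[eps --> (0 : R)^'+]
    --> limit_rho ul rhol ur rhor phi.
Proof.
move=> tphi; have [/(_ 0%N) cphi cK _] := tphi; rewrite /= in cphi.
have [T T0 phiT] := test_function_box tphi.
have [M M0 phiM] := test_function_bounded tphi.
have c0 : 0 < mass by rewrite mulr_gt0 ?subr_gt0// divr_gt0// addr_gt0.
have r0 : 0 < rhol + rhor by rewrite addr_gt0.
set J := \int[mu]_(t in `]0, +oo[) (t * phi (m * t, t)).
set Q := \int[mu]_(t in `]0, +oo[) (t * \1_`]0, T] t).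
have Q0 : 0 <= Q.
  apply: Rintegral_ge0 => t; rewrite /= in_itv/= andbT => t0.
  by rewrite mulr_ge0// ltW.
have ch : continuous (fun t => phi (m * t, t)).
  move=> t; apply: (@continuous_comp _ _ _ (fun t => (m * t, t)) phi); last exact: cphi.
  have mt : m * x @[x --> t] --> m * t by apply: cvgMr; exact: cvg_id.
  exact: cvg_pair mt cvg_id.
have deltaE : weighted_delta (fun t => mass * t) (fun t => m * t) phi = mass * J.
  rewrite /weighted_delta /J -RintegralZl//.
    by apply: eq_Rintegral => t _; exact/esym/mulrA.
  apply: integrableS (@integrable_first_moment R (fun t => phi (m * t, t)) M T _ _ _) => //.
  - exact: continuous_measurable_fun.
  - by move=> t /phiT[].
apply/cvgrPdist_lt => e e0.
have A0 : 0 < 3 * ((mass + 1) * (Q + 1)).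
  by apply: mulr_gt0 => //; apply: mulr_gt0; lra.
(* Makes the oscillation term Z eta Q at most e/3, given Z < mass + 1 for Z = rhos (s2 - s1). *)
set eta := e / (3 * ((mass + 1) * (Q + 1))).
have etaE : eta * (3 * ((mass + 1) * (Q + 1))) = e.
  by rewrite divfK// gt_eqF.
have eta0 : 0 < eta by exact: divr_gt0.
have [delta delta0 phidelta] := compact_support_unif_continuous cphi cK eta0.
set B := `|J| + (rhol + rhor) * M * Q + 1.
have B1 : 0 <= (rhol + rhor) * M * Q.
  by apply: mulr_ge0 => //; apply/ltW/mulr_gt0.
have B0 : 0 < B by have := normr_ge0 J; rewrite /B; lra.
(* The entry 1 gives Z < mass + 1, [delta / T] keeps the strip narrower than [delta] up to time [T],
   and the last makes the remaining errors small. *)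
pose e' := Num.min (Num.min 1 (delta / T)) (e / (3 * B)).
have e'0 : 0 < e' by rewrite !lt_min ltr01 !divr_gt0// mulr_gt0.
apply: filterS (two_shocks_near e'0) => eps.
move=> [mrho [us [rhos [s1 [s2 [[rhos0 s1ms2 _ + +] sol]]]]]].
have /andP[s1m ms2] := s1ms2.
set w := s2 - s1; have w0 : 0 < w by rewrite subr_gt0 (lt_trans s1m).
rewrite !lt_min => /andP[/andP[_ wT] wB] /andP[/andP[m1 _] mB].
rewrite distrC.
have sol' x t : 0 < t -> [/\ x < s1 * t -> rho eps (x, t) = rhol,
    s1 * t < x < s2 * t -> rho eps (x, t) = rhos &
    s2 * t < x -> rho eps (x, t) = rhor].
  by move=> t0; have [H1 H2 H3] := sol x t t0; split=> [/H1[]|/H2[]|/H3[]].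
have osc x t : 0 < t <= T -> s1 * t <= x <= s2 * t ->
    `|phi (x, t) - phi (m * t, t)| <= eta.
  move=> /andP[t0 tT] /andP[x1 x2]; apply/ltW/phidelta.
  have s1mt : s1 * t < m * t by rewrite ltr_pM2r.
  have ms2t : m * t < s2 * t by rewrite ltr_pM2r.
  have wt : w * t < delta.
    apply: le_lt_trans (_ : w * T < _); first by rewrite ler_pM2l.
    by rewrite -ltr_pdivlMr.
  split; rewrite /ball/= ?subrr ?normr0//.
  by move: wt; rewrite /w mulrBl => wt; rewrite ltr_norml; apply/andP; split; lra.
have := strip_perturbation (ltW rhol_gt0) (ltW rhor_gt0) (ltW rhos0) s1ms2 T0
  mrho sol' cphi phiT phiM osc.
rewrite -/w -/J -/Q.
have -> : limit_rho ul rhol ur rhor phi =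
    regular_distribution (left_of m) (cst rhol) phi +
    regular_distribution (right_of m) (cst rhor) phi + mass * J.
  by rewrite /limit_rho deltaE.
set I := regular_distribution setT _ _.
set I0 := regular_distribution (left_of m) _ _ + _.
set Z := rhos * w in m1 mB * => est.
have -> : I - (I0 + mass * J) = (I - I0 - Z * J) + (Z - mass) * J by ring.
apply: le_lt_trans (ler_normD _ _) _; rewrite normrM.
have J0 := normr_ge0 J; have := ler_norm (Z - mass).
move: wB mB; rewrite !ltr_pdivlMr ?mulr_gt0// => wB mB Z1.
have Z0 : 0 < Z by rewrite mulr_gt0.
have N0 := normr_ge0 (Z - mass).
have Zm : 0 <= mass + 1 - Z by lra.
have h1 : Z * eta * Q * 3 <= e.
  rewrite -etaE.
  have : 0 <= eta * ((mass + 1 - Z) * Q).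
    by apply: mulr_ge0; [exact: ltW|exact: mulr_ge0].
  have : 0 <= eta * (mass + 1) by apply: mulr_ge0; lra.
  lra.
(* [y] dominates both small quantities, so y B < e/3 controls w (rhol + rhor) M Q and |Z - mass| |J|
   together; with [h1] the total is below 2e/3. *)
set y := Num.max w `|Z - mass|.
have wy : w <= y by rewrite le_max lexx.
have Zy : `|Z - mass| <= y by rewrite le_max lexx orbT.
have y0 : 0 <= y by exact: le_trans Zy.
have yB : y * (3 * B) < e by rewrite /y maxr_pMl ?gt_max ?wB ?mB// mulr_ge0// ltW.
have h2 := ler_wpM2r J0 Zy.
have h3 := ler_wpM2r B1 wy.
have BE : y * B = y * `|J| + y * ((rhol + rhor) * M * Q) + y by rewrite /B; ring.
have ZE : rhos * eta * (w * Q) = Z * eta * Q by rewrite /Z; ring.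
lra.
Qed.

End Conclusion.

Theorem theorem3p4 (R : realType) (f : R -> R) (ul ur rhol rhor : R)
    (u rho : R -> R * R -> R)
    (f_C2 : C2_on_pos f)
    (f_incr : forall r : R, 0 < r -> 0 < f^`() r)
    (f_convex : forall r : R, 0 < r -> 0 < f^`(2) r)
    (rhol_gt0 : 0 < rhol) (rhor_gt0 : 0 < rhor) (ur_lt_ul : ur < ul)
    (two_shocks : \forall eps \near (0 : R)^'+,
       lax_two_shock_solution f eps ul rhol ur rhor (u eps) (rho eps)) :
  (forall x t : R, 0 < t ->
     u eps (x, t) @[eps --> (0 : R)^'+] --> limit_u ul ur x t) /\
  (forall phi : R * R -> R, test_function phi ->
     regular_distribution setT (rho eps) phi @[eps --> (0 : R)^'+]
       --> limit_rho ul rhol ur rhor phi).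
Proof.
split=> [x t t0|phi tphi].
- exact: (pointwise_limit_u f_C2 f_incr f_convex rhol_gt0 rhor_gt0 ur_lt_ul two_shocks).
- exact: (distributional_limit_rho f_C2 f_incr f_convex rhol_gt0 rhor_gt0 ur_lt_ul two_shocks).
Qed.
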